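(* Let $1\le n<\omega$, $\mathcal I\subseteq\mathcal P(n)$, $d=\delta(\mathcal I)$, and let $\mathcal A=(A;E_0,\dots,E_{n-1})$ be an $(n,\mathcal I)$-grid with $|A|<\aleph_{d-1}$. Then $\mathcal A$ has an acceptable coloring.
   Context: An $n$-indexed hyperspace is $\mathcal A=(A;E_0,\dots,E_{n-1})$ with each $E_i$ an equivalence relation on $A$; $[a]_i$ is the $E_i$-class of $a$. It is an $(n,\mathcal I)$-grid if $\bigcap_{i\in I}[a]_i$ is finite for every $I\in\mathcal I$ and $a\in A$ (the intersection over $I=\emptyset$ being $A$). A coloring is $\chi:A\to n$; it is acceptable if for all $a\in A$, $i<n$, $\{x\in[a]_i:\chi(x)=i\}$ is finite. A set $T$ is a transversal of $\mathcal I$ if $T\cap I\ne\emptyset$ for all $I\in\mathcal I$. The depth $\delta(\mathcal I)$ is the least $d<\omega$ for which there are transversals $T_0,\dots,T_{d-1}\subseteq n$ of $\mathcal I$ with $T_0\cap\dots\cap T_{d-1}=\emptyset$ (so $\delta(\emptyset)=1$); if there are none (equivalently some $I\in\mathcal I$ has $|I|\le1$), $\delta(\mathcal I)=\infty$, with conventions $\infty-1=\infty$ and $\aleph_\infty$ larger than every cardinal (so the cardinality hypothesis is vacuous then). *)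

(* Defs.v *)
From mathcomp Require Import all_boot.
From mathcomp Require Import boolp classical_sets functions cardinality.

Set Implicit Arguments.
Unset Strict Implicit.
Unset Printing Implicit Defensive.

Local Open Scope classical_set_scope.
Local Open Scope card_scope.

Record hyperspace (n : nat) := Hyperspace {
  carrier :> Type;
  hrel : 'I_n -> carrier -> carrier -> Prop;
  hrel_equiv : forall i, RelationClasses.Equivalence (hrel i)
}.

Definition eqclass (n : nat) (A : hyperspace n) (i : 'I_n) (a : A) : set A :=
  [set x | hrel i a x].

(* For [I] empty, the intersection is the whole carrier. *)
Definition is_grid (n : nat) (II : {set {set 'I_n}}) (A : hyperspace n) : Prop :=
  forall I : {set 'I_n}, I \in II ->
  forall a : A, finite_set (\bigcap_(i in [set` I]) eqclass i a).

Definition acceptable (n : nat) (A : hyperspace n) (chi : A -> 'I_n) : Prop :=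
  forall (a : A) (i : 'I_n), finite_set [set x | eqclass i a x /\ chi x = i].

Definition transversal (n : nat) (II : {set {set 'I_n}}) (T : {set 'I_n}) : bool :=
  [forall I in II, T :&: I != finset.set0].

(* The intersection of the empty family ([d = 0]) is the whole of ['I_n]. *)
Definition empty_meet (n : nat) (II : {set {set 'I_n}}) (d : nat) : bool :=
  [exists T : {ffun 'I_d -> {set 'I_n}},
     [forall j, transversal II (T j)] &&
     ((\bigcap_(j < d) T j)%SET == finset.set0)].

(* [None] stands for infinity. *)
Definition depth (n : nat) (II : {set {set 'I_n}}) : option nat :=
  match pselect (exists d, empty_meet II d) with
  | left ex_d => Some (ex_minn ex_d)
  | right _ => None
  end.

Definition card_lt (T U : Type) : Prop :=
  ([set: T] #<= [set: U]) /\ ~ ([set: U] #<= [set: T]).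

(* [W] has cardinality aleph_k; aleph_(k+1) is the least cardinal greater than
   aleph_k. *)
Fixpoint has_card_aleph (k : nat) (W : Type) : Prop :=
  match k with
  | 0 => [set: W] #= [set: nat]
  | k'.+1 => exists V : Type,
      [/\ has_card_aleph k' V, card_lt V W &
          forall X : Type, card_lt V X -> [set: W] #<= [set: X]]
  end.

(* [None] stands for infinity, and aleph_infinity exceeds every cardinal. *)
Definition card_lt_aleph (A : Type) (k : option nat) : Prop :=
  match k with
  | Some k' => exists W : Type, has_card_aleph k' W /\ card_lt A W
  | None => True
  end.

(* Main.v *)
(** For [d = depth II], any [d - 1] transversals of [II] have a common point; call a
    set [T] of colours [k]-deep if it meets every intersection of [k] transversals.
    By induction on [k], a set [B] of fewer than aleph_k points can be coloured
    acceptably with the colours of a [k]-deep [T]. For [k = 1], [T] contains some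
    [I] in [II], and the points of the countable set [B] are coloured by enumerating
    classes. For larger [k], [B] is covered by a well-ordered chain of sets of
    smaller cardinality which are closed in the following sense: they contain [x] as
    soon as they meet the [i]-class of [x] for all [i] in some [I] in [II]. When [x]
    enters the chain, let [S] be the set of [i] such that an earlier stage meets the
    [i]-class of [x]. By closedness [S] contains no [I] in [II], so its complement is
    a transversal, [T :\: S] is [(k - 1)]-deep, and colouring the new points with it
    never disturbs a class met before. *)
Require Import Defs.
From mathcomp Require Import all_boot.
From mathcomp Require Import boolp classical_sets functions cardinality.
From mathcomp Require Import wochoice.

Set Implicit Arguments.
Unset Strict Implicit.
Unset Printing Implicit Defensive.

Local Open Scope classical_set_scope.
Local Open Scope card_scope.

(** * Strict well-orders *)

Definition strict_wo (T : Type) (lt : T -> T -> Prop) : Prop :=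
  well_founded lt /\ forall x y, [\/ lt x y, x = y | lt y x].

Lemma wf_min (T : Type) (lt : T -> T -> Prop) (P : T -> Prop) (x : T) :
  well_founded lt -> P x -> exists2 z, P z & forall y, P y -> ~ lt y z.
Proof.
move=> wf; elim: x / (wf x) => x _ IH Px.
have [[y [Py yx]]|nP] := pselect (exists y, P y /\ lt y x); first exact: IH Py.
by exists x => // y Py yx; apply: nP; exists y.
Qed.

Section StrictWellOrder.
Variables (T : Type) (lt : T -> T -> Prop).
Hypothesis wo : strict_wo lt.

Lemma strict_wo_irr x : ~ lt x x.
Proof. by have [z -> /(_ _ erefl)] := wf_min (P := eq^~ x) wo.1 erefl. Qed.

(** The least of [x], [y], [z] can only be [x], and then [z] neither equals nor precedes it. *)
Lemma strict_wo_trans x y z : lt x y -> lt y z -> lt x z.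
Proof.
move=> xy yz.
have [|m Pm minm] := @wf_min _ _ (fun u => [\/ u = x, u = y | u = z]) x wo.1.
  by constructor 1.
case: Pm minm => -> minm.
- case: (wo.2 x z) => // [xz|zx].
    by case: (minm y); [constructor 2|rewrite xz].
  by case: (minm z) => //; constructor 3.
- by case: (minm x) => //; constructor 1.
- by case: (minm y) => //; constructor 2.
Qed.

Lemma strict_wo_leP x y : ~ lt y x <-> lt x y \/ x = y.
Proof.
split=> [nyx|[xy yx|->]].
- by case: (wo.2 x y) => // ?; [left|right].
- exact: strict_wo_irr (strict_wo_trans xy yx).
- exact: strict_wo_irr.
Qed.

Lemma strict_wo_le_trans x y z : ~ lt y x -> ~ lt z y -> ~ lt z x.
Proof.
move=> /strict_wo_leP[xy|->//] /strict_wo_leP[yz|<-]; apply/strict_wo_leP; left=> //.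
exact: strict_wo_trans yz.
Qed.

Lemma strict_wo_max (I : eqType) (s : seq I) (f : I -> T) :
  s != [::] -> exists2 m, m \in s & forall i, i \in s -> ~ lt (f m) (f i).
Proof.
case: s => // i0 s _; elim: s i0 => [|j s IH] i0.
  by exists i0 => [|i]; rewrite inE // => /eqP ->; exact: strict_wo_irr.
have [m ms maxm] := IH j.
have [i0m|i0m] := pselect (lt (f m) (f i0)).
  exists i0 => [|i]; rewrite inE ?eqxx // => /predU1P[->|/maxm].
    exact: strict_wo_irr.
  by move=> mi i0i; apply: mi; exact: strict_wo_trans i0m i0i.
exists m => [|i]; first by rewrite inE ms orbT.
by rewrite inE => /predU1P[->|/maxm].
Qed.

End StrictWellOrder.

Lemma strict_wo_inj (T U : Type) (lt : T -> T -> Prop) (h : U -> T) :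
  strict_wo lt -> injective h -> strict_wo (fun a b => lt (h a) (h b)).
Proof.
move=> [wf tri] hinj; split.
  move=> x; move hx : (h x) => t; elim: t / (wf t) x hx => t _ IH x hx.
  by constructor=> y yx; apply: IH (erefl _); rewrite -hx.
by move=> x y; case: (tri (h x) (h y)) => [| /hinj |]; by constructor.
Qed.

Lemma strict_wo_lex (T I : Type) (ltI : I -> I -> Prop) (ltT : T -> T -> Prop)
    (r : T -> I) : strict_wo ltI -> strict_wo ltT ->
  strict_wo (fun x y => ltI (r x) (r y) \/ r x = r y /\ ltT x y).
Proof.
move=> [wfI triI] [wfT triT]; split.
  move=> x; move ri : (r x) => i.
  elim: i / (wfI i) x ri => i _ IHi x.
  elim: x / (wfT x) => x _ IHx rx; constructor=> y [yx|[rxy yx]].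
    by apply: IHi (erefl _); rewrite -rx.
  by apply: IHx => //; rewrite rxy.
move=> x y; case: (triI (r x) (r y)) => [xy|xy|yx].
- by constructor 1; left.
- case: (triT x y) => h; [constructor 1; right|constructor 2|constructor 3; right] => //.
- by constructor 3; left.
Qed.

Lemma ex_strict_wo (T : Type) : exists lt : T -> T -> Prop, strict_wo lt.
Proof.
have [R woR] := @well_ordering_principle {classic T}.
have woRT : wo_chain R predT by move=> P _; exact: woR.
have Rtot := wo_chainW woRT.
have Rxx x : R x x by exact: (wo_chain_reflexive woRT).
exists (fun x y => ~~ R y x); split.
  move=> x; apply: contrapT => nx.
  have [|z [[/asboolP zP zmin] _]] := woR [pred y | `[< ~ Acc (fun x y => ~~ R y x) y >]].
    by exists x; apply/asboolP.
  apply: zP; constructor=> y nzy; apply: contrapT => ny.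
  by move/negP: nzy; apply; apply: zmin; apply/asboolP.
move=> x y; have [yx|yx] := boolP (R y x); last by constructor 1.
have [xy|xy] := boolP (R x y); last by constructor 3.
by constructor 2; apply: (wo_chain_antisymmetric woRT) => //; rewrite xy yx.
Qed.

(** * Comparison of cardinals *)

Lemma card_le_inj (T U : Type) (A : set T) (B : set U) (f : T -> U) :
  (forall x, A x -> B (f x)) ->
  (forall x y, A x -> A y -> f x = f y -> x = y) -> A #<= B.
Proof.
move=> fAB finj.
have /card_eqPle[_ /card_le_trans] : f @` A #= A.
  by apply: inj_card_eq => x y; rewrite !inE; exact: finj.
by apply; apply: subset_card_le => _ [x Ax <-]; exact: fAB.
Qed.

Lemma card_leTP (T U : Type) (u0 : U) (A : set T) :
  A #<= [set: U] <->
  exists f : T -> U, forall x y, A x -> A y -> f x = f y -> x = y.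
Proof.
split=> [|[f finj]]; last exact: card_le_inj finj.
elim/Ppointed: U => U in u0 *; first by have := no u0.
move=> /pcard_injP[f finj]; exists f => x y Ax Ay.
by apply: finj; rewrite inE.
Qed.

Lemma card_le_injT (T U : Type) (B : set U) :
  [set: T] #<= B -> exists2 f : T -> U, injective f & forall x, B (f x).
Proof.
move=> /card_leP[f].
exists (fun x => val (f (to_setT x))).
  by move=> x y /val_inj /(@inj _ _ _ f); rewrite !inE => /(_ I I) [].
by move=> x; exact: set_valP.
Qed.

(* Map each point to a value not yet taken by its predecessors. *)
Lemma greedy_injection (T U : Type) (lt : T -> T -> Prop) : strict_wo lt ->
  (forall t, ~ ([set: U] #<= [set s | lt s t])) -> [set: T] #<= [set: U].
Proof.
move=> [wf tri] nle.
have [[t0]|nT] := pselect (inhabited T); last first.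
  apply: (@card_le_inj _ _ _ _ (fun t => False_rect U (nT (inhabits t)))) => // t.
  by case: nT.
have [[u0]|nU] := pselect (inhabited U); last first.
  case: (nle t0).
  by apply: (@card_le_inj _ _ _ _ (fun u => False_rect T (nU (inhabits u)))) => u;
    case: nU.
elim/Pchoice: U => U in u0 nle *.
pose F (t : T) (f : forall s, lt s t -> U) : U :=
  xget u0 [set u | forall s (st : lt s t), f s st <> u].
pose f := Fix wf (fun _ => U) F.
have fE t : f t = xget u0 [set u | forall s, lt s t -> f s <> u].
  rewrite /f Fix_eq // => x g h gh; rewrite /F; congr xget.
  by apply/seteqP; split=> u /= fu s st; [rewrite -gh|rewrite gh]; exact: fu.
have fP t s : lt s t -> f s <> f t.
  rewrite [f t]fE; case: xgetP => [u -> /= uP|nu _]; first exact: uP.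
  case: (nle t).
  (* Here the predecessors of [t] have used up all of [U]; choosing one predecessor per value embeds
     [U] below [t]. *)
  have /choice[g gP] : forall u, exists s, lt s t /\ f s = u.
    move=> u; have /existsNP[s'] := nu u => /not_implyP[s't /contrapT fs'].
    by exists s'.
  apply: (@card_le_inj _ _ _ _ g) => [u _|u v _ _ guv]; first by case: (gP u).
  by rewrite -(gP u).2 -(gP v).2 guv.
apply: (@card_le_inj _ _ _ _ f) => // x y _ _ fxy.
by case: (tri x y) => // /fP; rewrite fxy.
Qed.

(** Well-order [A]: either the greedy injection into [B] succeeds, or [B] embeds in an initial
    segment of [A]. *)
Lemma card_le_total (T U : Type) (A : set T) (B : set U) : A #<= B \/ B #<= A.
Proof.
rewrite -(card_le_eql (card_setT A)) -(card_le_eqr (card_setT B)).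
rewrite -(card_le_eqr (card_setT A)) -(card_le_eql (card_setT B)).
have [lt wo] := ex_strict_wo A.
have [|/existsNP[t /contrapT le]] :=
  pselect (forall t, ~ ([set: B] #<= [set s | lt s t])).
  by move=> /(greedy_injection wo); left.
by right; apply: card_le_trans le (card_leT _).
Qed.

(* Hilbert's hotel. *)
Lemma card_le_setU1 (T V : Type) (A : set T) (x : T) :
  [set: nat] #<= [set: V] -> A #<= [set: V] -> A `|` [set x] #<= [set: V].
Proof.
move=> /card_le_injT[g ginj _] /(card_leTP (g 0)) [f finj].
have [h [hinj h0]] : exists h : V -> V, injective h /\ forall v, h v <> g 0.
  pose P v v' := (exists2 k, v = g k & v' = g k.+1) \/ (forall k, v <> g k) /\ v' = v.
  have /choice[h hP] : forall v, exists v', P v v'.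
    move=> v; have [[k vk]|nv] := pselect (exists k, v = g k).
      by exists (g k.+1); left; exists k.
    by exists v; right; split=> // k vk; apply: nv; exists k.
  exists h; split=> [u v huv|v].
    move: (hP u) (hP v); rewrite huv => -[[k uk ->]|[nu ->]] [[l vl e]|[nv e]].
    - by move/ginj: e => [kl]; rewrite uk vl kl.
    - by case: (nv k.+1).
    - by case: (nu l.+1).
    - by rewrite -e.
  by case: (hP v) => [[k _ ->] /ginj//|[nv ->]]; exact: nv.
apply/(card_leTP (g 0)).
exists (fun y => if pselect (y = x) then g 0 else h (f y)) => y z.
case: pselect => yx; case: pselect => zx /=.
- by rewrite yx zx.
- by move=> _ _ /esym/h0.
- by move=> _ _ /h0.
- by move=> [Ay|/yx//] [Az|/zx//] /hinj; exact: finj.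
Qed.

(** * Successor cardinals *)

Section SuccessorCardinal.
Variables V W : Type.
Hypothesis V_lt_W : card_lt V W.
Hypothesis W_least : forall X : Type, card_lt V X -> [set: W] #<= [set: X].

(** Otherwise [V] would be strictly below [A], and leastness of [W] would embed [W] in [A]. *)
Lemma card_lt_succ (T : Type) (A : set T) : ~ ([set: W] #<= A) -> A #<= [set: V].
Proof.
move=> nWA; have [//|VA] := card_le_total A [set: V].
apply: contrapT => nAV; apply: nWA.
rewrite -(card_le_eqr (card_setT A)); apply: W_least; split.
  by rewrite (card_le_eqr (card_setT A)).
by rewrite (card_le_eql (card_setT A)).
Qed.

Lemma succ_strict_wo : [set: nat] #<= [set: V] ->
  exists2 lt : W -> W -> Prop,
    strict_wo lt & forall w, [set v | ~ lt w v] #<= [set: V].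
Proof.
move=> infV.
have [lt wo ltV] : exists2 lt : W -> W -> Prop, strict_wo lt &
    forall w, [set v | lt v w] #<= [set: V].
  have [lt wo] := ex_strict_wo W.
  have [|/existsNP[w0 nw0]] := pselect (forall w, [set v | lt v w] #<= [set: V]).
    by exists lt.
  (* Cut at the first [w] with too large an initial segment: [W] embeds below [w], where all initial
     segments are small, and the order is pulled back. *)
  have [w nw wmin] := wf_min (P := fun w => ~ ([set v | lt v w] #<= [set: V])) wo.1 nw0.
  have /card_le_injT[h hinj hw] : [set: W] #<= [set v | lt v w].
    by apply: contrapT => /card_lt_succ.
  exists (fun a b => lt (h a) (h b)); first exact: strict_wo_inj.
  move=> b; apply: (@card_le_trans _ _ _ [set v | lt v (h b)]).
    by apply: (@card_le_inj _ _ _ _ h) => // x y _ _; exact: hinj.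
  by apply: contrapT => /wmin; apply; exact: hw.
(* The closed segment has one more point, absorbed because [V] is infinite. *)
exists lt => // w; have := card_le_setU1 w infV (ltV w); apply: card_le_trans.
by apply: subset_card_le => v /(strict_wo_leP wo)[|->]; [left|right].
Qed.

(** Order the points by the first stage containing them, breaking ties by any well-order. Each
    initial segment lies in a single stage, so [W] does not embed in it and the greedy injection
    applies. *)
Lemma card_chain_union (T I : Type) (lt : I -> I -> Prop) (Y : I -> set T) :
  strict_wo lt -> (forall i j, ~ lt j i -> Y i `<=` Y j) ->
  (forall i, Y i #<= [set: V]) -> \bigcup_i Y i #<= [set: W].
Proof.
move=> wo Ymono YV; set U := \bigcup_i Y i.
have /choice[r rP] : forall x : U, exists i, Y i (val x) /\
    forall j, Y j (val x) -> ~ lt j i.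
  move=> x; have [i _ Yix] := set_valP x.
  by have [j Yj jmin] := wf_min (P := fun i => Y i (val x)) wo.1 Yix; exists j.
have [ltU woU] := ex_strict_wo U.
rewrite -(card_le_eql (card_setT U)).
apply: greedy_injection (strict_wo_lex r wo woU) _ => u Wu.
apply: V_lt_W.2; apply: card_le_trans Wu _; apply: card_le_trans (YV (r u)).
apply: (@card_le_inj _ _ _ _ val) => [x /= xu|x y _ _]; last exact: val_inj.
apply: Ymono (rP x).1; apply/(strict_wo_leP wo).
by case: xu => [|[]]; [left|right].
Qed.

End SuccessorCardinal.

Lemma aleph_infinite k W : has_card_aleph k W -> [set: nat] #<= [set: W].
Proof.
elim: k W => [|k IH] W /=; first by rewrite card_eq_le => /andP[].
by move=> [V [/IH nV [VW _] _]]; exact: card_le_trans VW.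
Qed.

(** * Closed sets in a grid *)

Section Grid.
Variables (n : nat) (II : {set {set 'I_n}}) (A : hyperspace n).
Hypothesis hgrid : is_grid II A.
Hypothesis II_neq0 : finset.set0 \notin II.

Let hrefl (i : 'I_n) (x : A) : hrel i x x.
Proof. by case: (hrel_equiv A i). Qed.

Let hsym (i : 'I_n) (x y : A) : hrel i x y -> hrel i y x.
Proof. by case: (hrel_equiv A i) => _ s _; exact: s. Qed.

Let htrans (i : 'I_n) (x y z : A) : hrel i x y -> hrel i y z -> hrel i x z.
Proof. by case: (hrel_equiv A i) => _ _ t; exact: t. Qed.

Lemma enum_neq0 (I : {set 'I_n}) : I \in II -> enum I != [::].
Proof.
move=> III; apply: contraNneq II_neq0 => I0.
suff -> : finset.set0 = I by [].
by apply/setP => i; rewrite finset.in_set0 -mem_enum I0.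
Qed.

Definition grid_closed (X : set A) : Prop := forall (I : {set 'I_n}) (x : A),
  I \in II -> (forall i, i \in I -> exists2 y, X y & hrel i y x) -> X x.

Definition grid_closure (X : set A) : set A :=
  [set x | forall Y : set A, grid_closed Y -> X `<=` Y -> Y x].

Lemma sub_grid_closure X : X `<=` grid_closure X.
Proof. by move=> x Xx Y _; exact. Qed.

Lemma grid_closureS X Y : X `<=` Y -> grid_closure X `<=` grid_closure Y.
Proof. by move=> XY x Xx Z cZ YZ; apply: Xx => //; exact: subset_trans YZ. Qed.

Lemma grid_closure_closed X : grid_closed (grid_closure X).
Proof.
move=> I x III Ix Y cY XY; apply: (cY I) => // i /Ix[y yX yx].
by exists y => //; exact: yX.
Qed.

(** As [I] is finite and nonempty, one of the witnessing stages is the last; it contains all the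
    witnesses, hence [x]. The predicate [P] admits all stages when a union is shown closed, and only
    the earlier ones in the filtration. *)
Lemma grid_closed_chain (J : Type) (lt : J -> J -> Prop) (Y : J -> set A) :
  strict_wo lt -> (forall i j, ~ lt j i -> Y i `<=` Y j) ->
  (forall j, grid_closed (Y j)) ->
  forall (I : {set 'I_n}) (x : A) (P : J -> Prop), I \in II ->
  (forall i, i \in I -> exists j y, [/\ P j, Y j y & hrel i y x]) ->
  exists2 j, P j & Y j x.
Proof.
move=> wo Ymono cY I x P III Ix.
have [[j0]|nJ] := pselect (inhabited J); last first.
  have := enum_neq0 III; case E : (enum I) => [//|i s] _.
  have /Ix[j] : i \in I by rewrite -mem_enum E mem_head.
  by case: nJ.
have /choice[j jP] : forall i, exists j, i \in I ->
    exists y, [/\ P j, Y j y & hrel i y x].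
  by move=> i; have [/Ix[j jP]|] := boolP (i \in I); [exists j|exists j0].
have [m] := strict_wo_max wo j (enum_neq0 III).
rewrite mem_enum => mI mmax; exists (j m); first by have [y []] := jP _ mI.
apply: (cY _ I) => // i iI; have [y [_ Yy yx]] := jP _ iI.
by exists y => //; apply: Ymono Yy; apply: mmax; rewrite mem_enum.
Qed.

Lemma grid_finite (I : {set 'I_n}) (X : set A) : I \in II ->
  (forall x y, X x -> X y -> forall i, i \in I -> hrel i x y) -> finite_set X.
Proof.
move=> III Xh; have [->//|/set0P[a Xa]] := eqVneq X set0.
by apply: sub_finite_set (hgrid III a) => x Xx i /= iI; exact: Xh.
Qed.

(** One round of closing off. A function [f] names a representative in [X] for every index; over a
    countable [X] there are countably many, and each adds finitely many points for each [I]. *)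
Definition grid_step (X : set A) : set A :=
  X `|` \bigcup_(I in [set` II])
    \bigcup_(f in [set f : 'I_n -> A | forall i, X (f i)])
      [set x | forall i, i \in I -> hrel i (f i) x].

Lemma grid_step_countable X : countable X -> countable (grid_step X).
Proof.
move=> cX; rewrite /grid_step -bigcup2E.
apply: bigcup_countable => // -[|[|k]] _ //=.
apply: bigcup_countable => // I /= III; apply: bigcup_countable => [|f _].
  have /countable_injP[e einj] := cX.
  apply: (@card_le_trans _ _ _ [set: {ffun 'I_n -> nat}]); last exact: countableP.
  apply: (@card_le_inj _ _ _ _ (fun f => [ffun i => e (f i)])) => // f g fX gX fg.
  apply: funext => i; apply: einj; rewrite ?inE //.
  by move/ffunP/(_ i): fg; rewrite !ffunE.
apply: finite_set_countable; apply: grid_finite III _ => x y xf yf i iI.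
by apply: htrans (hsym (xf i iI)) (yf i iI).
Qed.

(** Countably many rounds of [grid_step] suffice, since a point is added on account of finitely many
    others. *)
Lemma grid_closure_countable X : countable X -> countable (grid_closure X).
Proof.
move=> cX; pose Z k := iter k grid_step X.
have ZS k l : (k <= l)%N -> Z k `<=` Z l.
  move=> /subnK <-; elim: (l - k)%N => // m IH x /IH Zx; by left.
apply: (@card_le_trans _ _ _ (\bigcup_k Z k)); last first.
  apply: bigcup_countable => // k _.
  by elim: k => // k; exact: grid_step_countable.
apply: subset_card_le => x; apply; last by move=> y Xy; exists 0%N.
move=> I {}x III Ix.
(* Indices outside [I] receive the default [y0], available because [I] is nonempty. *)
have /choice[f fP] : forall i, exists y, (exists k, Z k y) /\ (i \in I -> hrel i y x).
  have := enum_neq0 III; case E : (enum I) => [//|i0 s] _.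
  have /Ix[y0 [k0 _ Zy0] _] : i0 \in I by rewrite -mem_enum E mem_head.
  move=> i; have [/Ix[y [k _ Zy] yx]|] := boolP (i \in I).
    by exists y; split=> //; exists k.
  by exists y0; split=> //; exists k0.
have /choice[k kP] := fun i => (fP i).1.
exists (\max_i k i).+1 => //; right; exists I => //; exists f.
  by move=> i; apply: ZS (kP i); exact: leq_bigmax.
by move=> i iI; exact: (fP i).2.
Qed.

(** Enumerate [X] along [W]. The closures of the initial parts are bounded by the preceding aleph,
    and their increasing union is closed because closedness is a finitary condition. *)
Lemma grid_closure_aleph k W X : has_card_aleph k W ->
  X #<= [set: W] -> grid_closure X #<= [set: W].
Proof.
elim: k W X => [|k IH] W X.
  by move=> /= Wnat; rewrite !(card_le_eqr Wnat); exact: grid_closure_countable.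
move=> alephW; have /aleph_infinite/card_le_injT[g _ _] := alephW.
move: alephW => [V [alephV VW Wmin]] /(card_leTP (g 0))[e einj].
have [lt wo ltV] := succ_strict_wo Wmin (aleph_infinite alephV).
pose Y w := grid_closure [set x | X x /\ ~ lt w (e x)].
have Ymono i j : ~ lt j i -> Y i `<=` Y j.
  move=> ij; apply: grid_closureS => x [Xx xi]; split=> //.
  exact: strict_wo_le_trans xi ij.
have YV w : Y w #<= [set: V].
  apply: IH alephV _; apply: card_le_trans (ltV w).
  by apply: (@card_le_inj _ _ _ _ e) => [x []//|x y [Xx _] [Xy _]]; exact: einj.
apply: card_le_trans (card_chain_union VW wo Ymono YV).
apply: subset_card_le => x; apply => [I {}x III Ix|{}x Xx].
  have [||//|j _ Yx] := @grid_closed_chain _ _ Y wo Ymono _ I x (fun=> True).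
  - by move=> j; exact: grid_closure_closed.
  - exact: III.
  - by move=> i /Ix[y [j _ Yy] yx]; exists j, y.
  - by exists j.
exists (e x) => //; apply: sub_grid_closure; split=> //; exact: strict_wo_irr.
Qed.

(** * Acceptable colorings of subsets *)

Definition acceptable_on (B : set A) (T : {set 'I_n}) (chi : A -> 'I_n) : Prop :=
  (forall x, B x -> chi x \in T) /\
  forall a i, finite_set [set x | [/\ B x, hrel i a x & chi x = i]].

(* A point entering the filtration at stage [i] avoids the colours [k] for which
   its [k]-class already met an earlier stage, so a class is only coloured with
   its own index at the first stage that it meets. *)
Lemma filtered_coloring (J : Type) (lt : J -> J -> Prop) (Y : J -> set A)
    (B : set A) (T : {set 'I_n}) (c0 : 'I_n) :
  strict_wo lt -> (forall i j, ~ lt j i -> Y i `<=` Y j) ->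
  (forall j, grid_closed (Y j)) -> B `<=` \bigcup_j Y j ->
  (forall j (S : {set 'I_n}), Defs.transversal II (~: S)%SET ->
     exists chi, acceptable_on (B `&` Y j) (T :\: S)%SET chi) ->
  exists chi, acceptable_on B T chi.
Proof.
move=> wo Ymono cY BY colY.
(* One coloring is fixed for each stage and each [S], before points are considered, so that only
   finitely many are in use at a given stage. *)
have /choice[col colP] : forall p : J * {set 'I_n}, exists chi,
    Defs.transversal II (~: p.2)%SET -> acceptable_on (B `&` Y p.1) (T :\: p.2)%SET chi.
  move=> [j S]; have [/(colY j)[chi ?]|_] := boolP (Defs.transversal II (~: S)%SET).
    by exists chi.
  by exists (fun=> c0).
pose rk x j := Y j x /\ forall l, Y l x -> ~ lt l j.
have rk_uniq x i j : rk x i -> rk x j -> i = j.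
  by move=> [Yi mini] [Yj minj]; case: (wo.2 i j) => // [/minj|/mini].
have rk_ex x : B x -> exists j, rk x j.
  move=> /BY[j _ Yj].
  by have [i Yi imin] := wf_min (P := fun j => Y j x) wo.1 Yj; exists i.
pose S x j : {set 'I_n} :=
  [set k | `[< exists i y, [/\ lt i j, Y i y & hrel k y x] >]]%SET.
have StP x j : rk x j -> Defs.transversal II (~: S x j)%SET.
  move=> [Yj jmin]; apply/forall_inP => I III; apply/negP => /eqP SI.
  have [||i ij Yi] := @grid_closed_chain _ _ Y wo Ymono cY I x (fun i => lt i j).
  - exact: III.
  - move=> k kI; have : k \notin (~: S x j :&: I)%SET by rewrite SI finset.in_set0.
    by rewrite !finset.inE kI andbT negbK => /asboolP.
  - exact: jmin Yi ij.
have /choice[chi chiP] : forall x, exists c, forall j, rk x j -> c = col (j, S x j) x.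
  move=> x; have [[j xj]|nj] := pselect (exists j, rk x j).
    by exists (col (j, S x j) x) => i xi; rewrite (rk_uniq _ _ _ xi xj).
  by exists c0 => j xj; case: nj; exists j.
have chiTS x j : B x -> rk x j -> chi x \in (T :\: S x j)%SET.
  move=> Bx xj; rewrite (chiP _ _ xj).
  by apply: (colP (j, S x j) (StP _ _ xj)).1; split=> //; case: xj.
exists chi; split=> [x Bx|a k].
  by have [j xj] := rk_ex _ Bx; have := chiTS _ _ Bx xj; rewrite finset.inE => /andP[].
set F := [set x | _].
have [->//|/set0P[x0 [Bx0 ax0 chix0]]] := eqVneq F set0.
have [j x0j] := rk_ex _ Bx0.
(* If [x] entered before [y], the stage of [x] would meet the [k]-class of [y], and [k] would be
   forbidden for [y]. *)
have ltF x i y l : F x -> F y -> rk x i -> rk y l -> ~ lt i l.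
  move=> [Bx ax cx] [By ay cy] xi yl il.
  have := chiTS _ _ By yl; rewrite finset.inE cy => /andP[/negP + _]; apply.
  rewrite finset.inE; apply/asboolP; exists i, x; split=> //; first by case: xi.
  exact: htrans (hsym ax) ay.
have Frk x : F x -> rk x j.
  move=> Fx; have [Bx _ _] := Fx; have [i xi] := rk_ex _ Bx.
  have Fx0 : F x0 by [].
  by case: (wo.2 i j) => [/(ltF _ _ _ _ Fx Fx0 xi x0j)//|<-//|
                          /(ltF _ _ _ _ Fx0 Fx x0j xi)].
(* All of [F] enters at stage [j], so it is covered by one finite set for each of the finitely many
   [R]. *)
apply: (@sub_finite_set _ _ (\bigcup_(R in [set R | Defs.transversal II (~: R)%SET])
   [set x | [/\ (B `&` Y j) x, hrel k a x & col (j, R) x = k]])).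
  move=> x Fx; have xj := Frk _ Fx; have [Bx ax cx] := Fx.
  exists (S x j); first exact: StP.
  by split; rewrite // -?(chiP _ _ xj) //; split=> //; case: xj.
apply: bigcup_finite => [|R /= tR]; first exact: finite_finset.
exact: (colP (j, R) tR).2.
Qed.

(* Number each class by the least index of its points in [B], and colour a point
   by the member of [I] whose class has the largest number. *)
Lemma countable_coloring (B : set A) (T I : {set 'I_n}) :
  countable B -> I \in II -> I \subset T -> exists chi, acceptable_on B T chi.
Proof.
move=> /countable_injP[e einj] III IT.
have [i0 i0I] : exists i0, i0 \in I.
  have := enum_neq0 III; case E : (enum I) => [//|i s] _.
  by exists i; rewrite -mem_enum E mem_head.
have /choice[num numP] : forall p : 'I_n * A, exists y, B p.2 ->
    [/\ B y, hrel p.1 p.2 y & forall z, B z -> hrel p.1 p.2 z -> (e y <= e z)%N].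
  move=> [i x]; have [Bx|nBx] := pselect (B x); last by exists x.
  pose P m := `[< exists y, [/\ B y, hrel i x y & e y = m] >].
  have Pex : exists m, P m by exists (e x); apply/asboolP; exists x.
  have [m /asboolP[y [By xy <-]] ymin] := ex_minnP Pex.
  exists y => _; split=> // z Bz xz; apply: ymin; apply/asboolP; exists z.
  by split.
pose rho i x := e (num (i, x)).
have rhoE i x y : B x -> B y -> hrel i x y -> rho i x = rho i y.
  move=> Bx By xy; have /= [Bu xu umin] := numP (i, x) Bx.
  have /= [Bv yv vmin] := numP (i, y) By.
  apply/eqP; rewrite eqn_leq umin ?vmin //; first exact: htrans (hsym xy) xu.
  exact: htrans xy yv.
have rho_inj i x y : B x -> B y -> rho i x = rho i y -> hrel i x y.
  move=> Bx By rxy; have /= [Bu xu umin] := numP (i, x) Bx.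
  have /= [Bv yv vmin] := numP (i, y) By.
  apply: htrans xu _; rewrite (einj _ _ _ _ rxy) ?inE //; exact: hsym.
have /choice[chi chiP] : forall x, exists c, c \in I /\
    forall i, i \in I -> (rho i x <= rho c x)%N.
  by move=> x; case: (arg_maxnP (fun i => rho i x) i0I) => c cI cmax; exists c.
exists chi; split=> [x _|a k]; first exact: (fintype.subsetP IT) (chiP x).1.
set F := [set x | _].
have [->//|/set0P[x0 [Bx0 ax0 chix0]]] := eqVneq F set0.
(* On [F] the number of the [k]-class is constantly [N] and is the largest over [I], so finitely
   many vectors of class numbers occur. Each vector determines the [i]-classes for [i] in [I], so
   the grid condition leaves finitely many points. *)
pose N := rho k x0.
apply: (@sub_finite_set _ _ (\bigcup_(f in [set: {ffun 'I_n -> 'I_N.+1}])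
   [set x | B x /\ forall i, i \in I -> rho i x = f i])).
  (* For [i] outside [I] the value of [inord] may be arbitrary; the covering set constrains only [i]
     in [I]. *)
  move=> x [Bx ax chix]; exists [ffun i => inord (rho i x)] => //; split=> // i iI.
  rewrite ffunE inordK // ltnS; apply: leq_trans ((chiP x).2 i iI) _.
  rewrite chix /N (rhoE k x x0) //; exact: htrans (hsym ax) ax0.
apply: bigcup_finite => [|f _]; first exact: finite_finset.
apply: grid_finite III _ => x y [Bx xf] [By yf] i iI.
by apply: rho_inj => //; rewrite xf ?yf.
Qed.

(** * Deep sets of colors *)

Fixpoint deep (k : nat) (T : {set 'I_n}) : Prop :=
  match k with
  | 0 => T != finset.set0
  | k'.+1 => forall U, Defs.transversal II U -> deep k' (T :&: U)%SET
  end.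

Lemma deep_transversals k (T : {set 'I_n}) :
  (forall F : 'I_k -> {set 'I_n}, (forall j, Defs.transversal II (F j)) ->
     (T :&: \bigcap_(j < k) F j != finset.set0)%SET) -> deep k T.
Proof.
elim: k T => [|k IH] T HT /=.
  have /HT : forall j : 'I_0, Defs.transversal II T by case.
  by rewrite big_ord0 finset.setIT.
move=> U tU; apply: IH => F tF.
(* [U] is put in front of the family [F], at index 0. *)
have := HT (fun j => if unlift ord0 j is Some j' then F j' else U).
rewrite big_ord_recl unlift_none finset.setIA.
under eq_bigr do rewrite liftK.
by apply => j; case: unliftP.
Qed.

(** If [T] contained no member of [II], its complement would be a transversal disjoint from [T]. *)
Lemma deep1 (T : {set 'I_n}) : deep 1 T -> exists2 I, I \in II & I \subset T.
Proof.
move=> /= dT; apply: contrapT => nI.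
have /dT : Defs.transversal II (~: T)%SET; last by rewrite finset.setICr eqxx.
apply/forall_inP => I III; apply/negP => TI; apply: nI; exists I => //.
by rewrite -[T]finset.setCK -finset.disjoints_subset -setI_eq0 finset.setIC.
Qed.

Lemma deep_coloring (c0 : 'I_n) k W (B : set A) (T : {set 'I_n}) : has_card_aleph k W ->
  ~ ([set: W] #<= B) -> deep k T -> exists chi, acceptable_on B T chi.
Proof.
elim: k W B T => [|[|k] IH] W B T.
- move=> /= /card_eqPle[Wnat _] WB /set0Pn[i iT]; exists (fun=> i); split=> // a j.
  apply: (@sub_finite_set _ _ B) => [x []//|].
  by apply/finite_setPn => natB; apply: WB; exact: card_le_trans natB.
(* This case cannot use the filtration: the closure of a finite set is only known to be
   countable. *)
- move=> [V [Vnat VW Wmin]] WB /deep1[I III IT].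
  apply: countable_coloring III IT; rewrite /countable -(card_le_eqr Vnat).
  exact: card_lt_succ WB.
move=> [V [+ VW Wmin]] WB dT; rewrite -/(has_card_aleph k.+1 V) => alephV.
have /card_le_injT[g _ _] := aleph_infinite alephV.
have /(card_leTP (g 0))[e einj] : B #<= [set: V] by exact: card_lt_succ WB.
(* The induction hypothesis needs stages smaller than [V]. They are indexed by [V] itself, ordered
   so that each closed segment, and hence its closure, has size at most [V']. *)
have [V' [alephV' VV' Vmin]] := alephV.
have [lt wo ltV] := succ_strict_wo Vmin (aleph_infinite alephV').
pose Y w := grid_closure [set x | B x /\ ~ lt w (e x)].
apply: (@filtered_coloring _ lt Y) => //.
- move=> i j ij; apply: grid_closureS => x [Xx xi]; split=> //.
  exact: strict_wo_le_trans xi ij.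
- by move=> j; exact: grid_closure_closed.
- move=> x Bx; exists (e x) => //; apply: sub_grid_closure; split=> //.
  exact: strict_wo_irr.
move=> w S tS; apply: (IH V) => //; last by rewrite finset.setDE; exact: dT.
move=> VB; apply: VV'.2; apply: card_le_trans VB _.
apply: (@card_le_trans _ _ _ (Y w)); first by apply: subset_card_le => x [].
apply: grid_closure_aleph alephV' _; apply: card_le_trans (ltV w).
by apply: (@card_le_inj _ _ _ _ e) => [x []//|x y [Bx _] [By _]]; exact: einj.
Qed.

End Grid.

(** * Finite and infinite depth *)

Theorem theorem3p2 (n : nat) (hn : (1 <= n)%N) (II : {set {set 'I_n}})
    (A : hyperspace n) (hgrid : is_grid II A)
    (hcard : card_lt_aleph (carrier A) (omap predn (depth II))) :
  exists chi : A -> 'I_n, acceptable chi.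
Proof.
(* If the empty set is in [II], the space itself is finite. *)
have [II0|II0] := boolP (finset.set0 \in II).
  exists (fun=> Ordinal hn) => a i; apply: sub_finite_set (hgrid _ II0 a) => x _ j.
  by rewrite /= finset.in_set0.
move: hcard; rewrite /depth; case: pselect => [ex_d|nd] /=.
  case: ex_minnP => d dP dmin [W [alephW [_ AW]]].
  (* The empty meet is all of ['I_n], which is nonempty; so [d.-1] is a true predecessor. *)
  have d_gt0 : (0 < d)%N.
    rewrite lt0n; apply/eqP => d0; move: dP; rewrite d0 => /existsP[T /andP[_]].
    rewrite big_ord0 => /eqP/setP/(_ (Ordinal hn)).
    by rewrite finset.in_setT finset.in_set0.
  have [|chi [_ chiP]] := @deep_coloring _ _ _ hgrid II0 (Ordinal hn) _ _ [set: A]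
      [set: 'I_n]%SET alephW AW.
    (* A family of [d.-1] transversals with empty meet would contradict the minimality of [d]. *)
    apply: deep_transversals => F tF; apply/negP; rewrite finset.setTI => F0.
    suff /dmin : empty_meet II d.-1 by rewrite -ltnS prednK // ltnn.
    apply/existsP; exists [ffun j => F j]; apply/andP; split.
      by apply/forallP => j; rewrite ffunE.
    by under eq_bigr do rewrite ffunE.
  exists chi => a i; apply: sub_finite_set (chiP a i) => x [].
  by move=> ? ?.
(* Infinite depth: without a singleton in [II], the complements of singletons would be [n]
   transversals with empty meet. Given the singleton of [i], all [i]-classes are finite and the
   constant color [i] works. *)
have [i iI] : exists i, [set i]%SET \in II.
  apply: contrapT => nI; apply: nd; exists n; apply/existsP.
  exists [ffun j => ~: [set j]]%SET; apply/andP; split.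
    apply/forallP => j; rewrite ffunE; apply/forall_inP => I III.
    apply/negP; rewrite finset.setIC setI_eq0 finset.disjoints_subset finset.setCK.
    rewrite finset.subset1 => /predU1P[Ij|/eqP I0]; last by rewrite -I0 III in II0.
    by apply: nI; exists j; rewrite -Ij.
  apply/eqP/setP => j; rewrite finset.in_set0; apply/negP => /bigcapP/(_ j isT).
  by rewrite ffunE !finset.inE eqxx.
exists (fun=> i) => a j.
apply: sub_finite_set (hgrid _ iI a) => x [ax ij] k /=.
by rewrite finset.inE => /eqP ->; rewrite ij.
Qed.
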